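(* Let $\mathcal{A}, \mathcal{B} \in \mathcal{L}^q$ be finite-dimensional linear time-invariant behaviors with $q$ variables. Then the following hold. 1. If $\mathcal{A}$ and $\mathcal{B}$ are controllable, with image representations $\mathcal{A} = \operatorname{image} P_a(\sigma)$ and $\mathcal{B} = \operatorname{image} P_b(\sigma)$, then an image representation of their sum is given by the union of the generators: $$\mathcal{A} + \mathcal{B} = \operatorname{image} \begin{bmatrix} P_a & P_b \end{bmatrix}(\sigma).$$ 2. If $\mathcal{A} = \ker R_a(\sigma)$ and $\mathcal{B} = \ker R_b(\sigma)$ are kernel representations, then a kernel representation of their intersection is given by the union of the annihilators: $$\mathcal{A} \cap \mathcal{B} = \ker \begin{bmatrix} R_a \\ R_b \end{bmatrix}(\sigma).$$
   Context: The time axis is $\mathbb{Z}$ and trajectories are functions $w : \mathbb{Z} \to \mathbb{R}^q$. The shift operator is $(\sigma w)(t) = w(t+1)$. A behavior $\mathcal{B} \subseteq (\mathbb{R}^q)^{\mathbb{Z}}$ is linear if it is a subspace and time-invariant if it is invariant under $\sigma$. $\mathcal{L}^q$ denotes the set of linear time-invariant behaviors with $q$ variables; throughout, these are finite-dimensional, i.e. they admit a kernel representation. A kernel representation of $\mathcal{B}$ is $\mathcal{B} = \ker R(\sigma) := \{ w \in (\mathbb{R}^q)^{\mathbb{Z}} \mid R(\sigma) w = 0\}$, where $R(z) = R_0 + R_1 z + \cdots + R_\ell z^\ell$ is a real polynomial matrix with $q$ columns; the rows of $R$ are called annihilators of $\mathcal{B}$. An image representation of $\mathcal{B}$ is $\mathcal{B}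 = \operatorname{image} P(\sigma) := \{ w \in (\mathbb{R}^q)^{\mathbb{Z}} \mid w = P(\sigma) v \text{ for some } v \in (\mathbb{R}^m)^{\mathbb{Z}}\}$, where $P(z)$ is a real $q \times m$ polynomial matrix; the columns of $P$ are called generators of $\mathcal{B}$. $\mathcal{B}$ is controllable if for all $w_1, w_2 \in \mathcal{B}$ there exist $\bar t > 0$ and $w \in \mathcal{B}$ such that $w(t) = w_1(t)$ for $t < 0$ and $w(t) = w_2(t)$ for $t \ge \bar t$. A controllable behavior in $\mathcal{L}^q$ has an image representation. The sum and intersection are $\mathcal{A} + \mathcal{B} = \{a + b \mid a \in \mathcal{A}, b \in \mathcal{B}\}$ and $\mathcal{A} \cap \mathcal{B} = \{w \mid w \in \mathcal{A} \text{ and } w \in \mathcal{B}\}$. *)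

(* Defs.v *)
From mathcomp Require Import all_boot all_order all_algebra.
From mathcomp Require Import boolp classical_sets functions reals.

Set Implicit Arguments.
Unset Strict Implicit.
Unset Printing Implicit Defensive.

Import Order.TTheory GRing.Theory Num.Theory.
Local Open Scope ring_scope.
Local Open Scope classical_set_scope.

Definition trajectory (R : realType) (q : nat) := int -> 'cV[R]_q.

Definition behavior (R : realType) (q : nat) := set (trajectory R q).

Definition sigma (R : realType) (q : nat) (w : trajectory R q) :
  trajectory R q := fun t => w (t + 1).

Definition linear_behavior (R : realType) (q : nat) (B : behavior R q) : Prop :=
  B 0 /\ forall (a : R) (u v : trajectory R q), B u -> B v -> B (a *: u + v).

Definition time_invariant (R : realType) (q : nat) (B : behavior R q) : Prop :=
  (@sigma R q) @` B `<=` B.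

(* M_k in M(z) = M_0 + M_1 z + ... + M_l z^l. *)
Definition coef_mx (R : realType) (g q : nat) (M : 'M[{poly R}]_(g, q))
  (k : nat) : 'M[R]_(g, q) := \matrix_(i, j) (M i j)`_k.

(* One more than the degree of M(z), and 0 when M = 0. *)
Definition size_mx (R : realType) (g q : nat) (M : 'M[{poly R}]_(g, q)) : nat :=
  (\max_(i < g) \max_(j < q) size (M i j))%N.

(* M(sigma) w = M_0 w + M_1 (sigma w) + ... + M_l (sigma^l w). *)
Definition shift_op (R : realType) (g q : nat) (M : 'M[{poly R}]_(g, q))
  (w : trajectory R q) : trajectory R g :=
  fun t => \sum_(k < size_mx M) coef_mx M k *m iter k (@sigma R q) w t.

Definition ker_behavior (R : realType) (g q : nat) (M : 'M[{poly R}]_(g, q)) :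
  behavior R q := [set w | shift_op M w = 0].

Definition image_behavior (R : realType) (q m : nat)
  (P : 'M[{poly R}]_(q, m)) : behavior R q :=
  [set w | exists v : trajectory R m, w = shift_op P v].

Definition kernel_representation (R : realType) (g q : nat)
  (M : 'M[{poly R}]_(g, q)) (B : behavior R q) : Prop := B = ker_behavior M.

Definition image_representation (R : realType) (q m : nat)
  (P : 'M[{poly R}]_(q, m)) (B : behavior R q) : Prop := B = image_behavior P.

(* The class L^q: finite-dimensionality means having a kernel representation;
   the number g of its rows is arbitrary, and g = 0 gives the full space. *)
Definition finite_dim_LTI (R : realType) (q : nat) (B : behavior R q) : Prop :=
  [/\ linear_behavior B, time_invariant B &
      exists (g : nat) (M : 'M[{poly R}]_(g, q)), kernel_representation M B].

Definition controllable (R : realType) (q : nat) (B : behavior R q) : Prop :=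
  forall w1 w2 : trajectory R q, B w1 -> B w2 ->
  exists (tbar : int) (w : trajectory R q),
    [/\ 0 < tbar, B w, forall t : int, t < 0 -> w t = w1 t &
        forall t : int, tbar <= t -> w t = w2 t].

Definition behavior_sum (R : realType) (q : nat) (A B : behavior R q) :
  behavior R q := [set a + b | a in A & b in B].

(* Main.v *)
Require Import Defs.
From mathcomp Require Import all_boot all_order all_algebra.
From mathcomp Require Import boolp classical_sets functions reals.

Import GRing.Theory.

Local Open Scope ring_scope.
Local Open Scope classical_set_scope.

(** A polynomial operator in the shift acts blockwise. On a stacked input, [row_mx Pa Pb] gives the
    sum of the two outputs, and every input is stacked from its upper and lower parts;
    [col_mx Ra Rb] gives the stacked outputs, which vanish exactly when both blocks do. Lemmas
    [shift_op_row_mx] and [shift_op_col_mx] reduce this to block products of constant matrices, one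
    power of the shift at a time; [shift_op_widen] aligns the summation ranges. *)

Lemma iter_sigmaE {R : realType} {q : nat} (k : nat) (w : trajectory R q)
    (t : int) :
  iter k (@sigma R q) w t = w (t + k%:Z).
Proof.
elim: k t => [|k IHk] t /=; first by rewrite addr0.
by rewrite /sigma IHk -addrA -PoszD add1n.
Qed.

Lemma coef_mx_eq0 {R : realType} {g q : nat} (M : 'M[{poly R}]_(g, q))
    (k : nat) :
  (size_mx M <= k)%N -> coef_mx M k = 0.
Proof.
move=> leMk; apply/matrixP => i j; rewrite !mxE nth_default//.
apply: leq_trans leMk; apply: leq_trans (leq_bigmax i).
exact: (leq_bigmax (F := fun j => size (M i j))).
Qed.

(* Any bound on the degrees can replace [size_mx M], so that the blocks of a
   block matrix, whose degrees differ, can be summed over a common range. *)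
Lemma shift_op_widen {R : realType} {g q : nat} (N : nat)
    (M : 'M[{poly R}]_(g, q)) (w : trajectory R q) (t : int) :
  (size_mx M <= N)%N ->
  shift_op M w t = \sum_(k < N) coef_mx M k *m w (t + k%:Z).
Proof.
move=> leMN; rewrite /shift_op.
rewrite (big_ord_widen N (fun k => coef_mx M k *m iter k (@sigma R q) w t))//.
rewrite big_mkcond; apply: eq_bigr => k _; rewrite iter_sigmaE.
by case: ltnP => // /coef_mx_eq0 ->; rewrite mul0mx.
Qed.

Lemma coef_row_mx {R : realType} {q ma mb : nat} (Pa : 'M[{poly R}]_(q, ma))
    (Pb : 'M[{poly R}]_(q, mb)) (k : nat) :
  coef_mx (row_mx Pa Pb) k = row_mx (coef_mx Pa k) (coef_mx Pb k).
Proof.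
apply/matrixP => i j; rewrite !mxE.
by case: fintype.split => l; rewrite mxE.
Qed.

Lemma coef_col_mx {R : realType} {q ga gb : nat} (Ra : 'M[{poly R}]_(ga, q))
    (Rb : 'M[{poly R}]_(gb, q)) (k : nat) :
  coef_mx (col_mx Ra Rb) k = col_mx (coef_mx Ra k) (coef_mx Rb k).
Proof.
apply/matrixP => i j; rewrite !mxE.
by case: fintype.split => l; rewrite mxE.
Qed.

Lemma shift_op_row_mx {R : realType} {q ma mb : nat}
    (Pa : 'M[{poly R}]_(q, ma)) (Pb : 'M[{poly R}]_(q, mb))
    (va : trajectory R ma) (vb : trajectory R mb) :
  shift_op (row_mx Pa Pb) (fun t => col_mx (va t) (vb t)) =
  shift_op Pa va + shift_op Pb vb.
Proof.
apply/funext => t; rewrite fctE.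
(* A common bound for all three matrices puts the three sums on one range, so they can be compared
   term by term. *)
pose N := maxn (size_mx (row_mx Pa Pb)) (maxn (size_mx Pa) (size_mx Pb)).
rewrite !(shift_op_widen N) ?leq_max ?leqnn ?orbT// -big_split /=.
by apply: eq_bigr => k _; rewrite coef_row_mx mul_row_col.
Qed.

Lemma shift_op_col_mx {R : realType} {q ga gb : nat}
    (Ra : 'M[{poly R}]_(ga, q)) (Rb : 'M[{poly R}]_(gb, q))
    (w : trajectory R q) (t : int) :
  shift_op (col_mx Ra Rb) w t = col_mx (shift_op Ra w t) (shift_op Rb w t).
Proof.
pose N := maxn (size_mx (col_mx Ra Rb)) (maxn (size_mx Ra) (size_mx Rb)).
rewrite !(shift_op_widen N) ?leq_max ?leqnn ?orbT//.
(* Stacking is compatible with zero and addition, so the relation between the three sums follows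
   from the same relation between their terms. *)
apply: (big_ind3 (fun x y z => x = col_mx y z)) => [|_ ya za _ yb zb -> ->|k _].
- by rewrite col_mx0.
- by rewrite add_col_mx.
- by rewrite coef_col_mx mul_col_mx.
Qed.

Lemma image_row_mx {R : realType} {q ma mb : nat}
    (Pa : 'M[{poly R}]_(q, ma)) (Pb : 'M[{poly R}]_(q, mb)) :
  behavior_sum (image_behavior Pa) (image_behavior Pb) =
  image_behavior (row_mx Pa Pb).
Proof.
apply/seteqP; split => [_ [_ [va ->] [_ [vb ->] <-]]|_ [v ->]].
  by exists (fun t => col_mx (va t) (vb t)); rewrite shift_op_row_mx.
(* The input [v] is cut at each time: its first [ma] entries drive [Pa] and its last [mb] entries
   drive [Pb]. *)
exists (shift_op Pa (fun t => usubmx (v t))); first by exists (usubmx \o v).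
exists (shift_op Pb (fun t => dsubmx (v t))); first by exists (dsubmx \o v).
rewrite -shift_op_row_mx; congr shift_op.
by apply/funext => t; rewrite vsubmxK.
Qed.

Lemma ker_col_mx {R : realType} {q ga gb : nat}
    (Ra : 'M[{poly R}]_(ga, q)) (Rb : 'M[{poly R}]_(gb, q)) :
  ker_behavior Ra `&` ker_behavior Rb = ker_behavior (col_mx Ra Rb).
Proof.
apply/seteqP; split => [w [/= wa wb]|w /= w0].
  by apply/funext => t; rewrite shift_op_col_mx wa wb col_mx0.
(* At each time the zero column is itself a stack of zeros, so equality of stacks separates the two
   blocks. *)
have w0t t : shift_op Ra w t = 0 /\ shift_op Rb w t = 0.
  by apply/eq_col_mx; rewrite -shift_op_col_mx w0 col_mx0.
by split; apply/funext => t; have [] := w0t t.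
Qed.

Theorem theorem1 (R : realType) (q : nat) (A B : behavior R q)
    (hA : finite_dim_LTI A) (hB : finite_dim_LTI B) :
  (forall (ma mb : nat) (Pa : 'M[{poly R}]_(q, ma)) (Pb : 'M[{poly R}]_(q, mb)),
     controllable A -> controllable B ->
     image_representation Pa A -> image_representation Pb B ->
     image_representation (row_mx Pa Pb) (behavior_sum A B))
  /\
  (forall (ga gb : nat) (Ra : 'M[{poly R}]_(ga, q)) (Rb : 'M[{poly R}]_(gb, q)),
     kernel_representation Ra A -> kernel_representation Rb B ->
     kernel_representation (col_mx Ra Rb) (A `&` B)).
Proof.
split=> [ma mb Pa Pb _ _ -> ->|ga gb Ra Rb -> ->].
- exact: image_row_mx.
- exact: ker_col_mx.
Qed.
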